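(* Let $b\geq 2$ and $\rho\geq 1$ be integers, let $\Lambda=(\lambda_1,\ldots,\lambda_\rho)$ be an integer sequence with $1\leq\lambda_1\leq\cdots\leq\lambda_\rho$, let $T=(t_{\ell,i})_{1\leq\ell\leq\rho,\,1\leq i\leq\lambda_\ell}$ be a tuple of positive integer parameters, and let $Z=(z_{\ell,i})_{1\leq\ell\leq\rho,\,1\leq i\leq\lambda_\ell}$ be a tuple of variables. Furthermore, for integers $k_{\ell,i}\in M_b$ let $$D_{\ell,i}:=d^b_{t_{\ell,i}}(k_{\ell,i}),\qquad 1\leq i\leq\lambda_\ell\ \text{ and }\ 1\leq\ell\leq\rho.$$ Then for each integer $n\geq 0$ we have $$\Omega_{b,T}^\Lambda(n;Z)=\sum\prod_{\ell=1}^{\rho}\binom{k_{\ell,1}+\cdots+k_{\ell,\lambda_\ell}}{k_{\ell,1},\ldots,k_{\ell,\lambda_\ell}}_b^*\,z_{\ell,1}^{D_{\ell,1}}\cdots z_{\ell,\lambda_\ell}^{D_{\ell,\lambda_\ell}},$$ where the sum is taken over all integers $k_{\ell,i}\in M_b$ with $1\leq i\leq\lambda_\ell$ and $1\leq\ell\leq\rho$, such that $$\sum_{\ell=1}^{\rho}\sum_{i=1}^{\lambda_\ell}i\cdot k_{\ell,i}=n.$$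
   Context: The polynomials $\Omega_{b,T}^\Lambda(n;Z)$ in the $\lambda_1+\cdots+\lambda_\rho$ variables $z_{\ell,i}$ are defined by the generating function (a formal power series identity in $q$) $$\sum_{n=0}^\infty\Omega_{b,T}^\Lambda(n;Z)q^n=\prod_{j=0}^\infty\prod_{\ell=1}^\rho\left(1+z_{\ell,1}^{t_{\ell,1}^j}q^{b^j}+z_{\ell,2}^{t_{\ell,2}^j}q^{2\cdot b^j}+\cdots+z_{\ell,\lambda_\ell}^{t_{\ell,\lambda_\ell}^j}q^{\lambda_\ell\cdot b^j}\right).$$ $M_b:=\{\sum_{j\geq 0}c_jb^j\mid c_j\in\{0,1\}\}$ (finite sums) is the set of all nonnegative integers whose $b$-ary digits are only $0$ or $1$. For $k\in M_b$ with $k=\sum_{j\geq0}c_jb^j$, $c_j\in\{0,1\}$, and an integer $t\geq 1$, define $d_t^b(k):=\sum_{j\geq 0}c_jt^j$. For nonnegative integers $m_1,\ldots,m_r$, the starred multinomial coefficient $\binom{m_1+\cdots+m_r}{m_1,\ldots,m_r}^*\in\{0,1\}$ is the least nonnegative residue modulo $2$ of the multinomial coefficient $\frac{(m_1+\cdots+m_r)!}{m_1!\cdots m_r!}$. For $k_1,\ldots,k_r\in M_b$ define $$\binom{k_1+\cdots+k_r}{k_1,\ldots,k_r}_b^*:=\binom{d_2^b(k_1)+\cdots+d_2^b(k_r)}{d_2^b(k_1),\ldots,d_2^b(k_r)}^*.$$ *)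

(* Defs.v *)
From HB Require Import structures.
From mathcomp Require Import all_boot all_order all_algebra.
From mathcomp Require Import mpoly.
Set Implicit Arguments.
Unset Strict Implicit.
Unset Printing Implicit Defensive.
Import GRing.Theory.

(* The coefficient of b^j in the base-b expansion of k (for 1 < b). *)
Definition digit (b k j : nat) : nat := (k %/ b ^ j) %% b.

(* The set M_b. Testing the positions j < k is enough, since k < b ^ k when
   1 < b; see [Mb_sumP]. *)
Definition Mb (b : nat) : pred nat :=
  [pred k : nat | [forall j : 'I_k, digit b k j <= 1]].

(* The map d_t^b, read off the base-b digits of k; see [dmap_sum]. *)
Definition dmap (b t k : nat) : nat := \sum_(j < k) digit b k j * t ^ j.

(* The division is exact. *)
Definition multinomial (r : nat) (m : 'I_r -> nat) : nat :=
  (\sum_(i < r) m i)`! %/ \prod_(i < r) (m i)`!.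

Definition multinomial_star (r : nat) (m : 'I_r -> nat) : nat :=
  multinomial m %% 2.

Definition multinomial_star_b (b r : nat) (k : 'I_r -> nat) : nat :=
  multinomial_star (fun i => dmap b 2 (k i)).

Section Digits.
Local Open Scope nat_scope.

Lemma digit_sum b J (c : nat -> bool) i : 1 < b ->
  digit b (\sum_(j < J) c j * b ^ j) i = (i < J) && c i.
Proof.
move=> b1; rewrite /digit; elim: J c i => [|J IH] c i.
  by rewrite big_ord0 div0n mod0n.
have b0 : 0 < b by apply: ltnW.
have cb (x : bool) : x < b by case: x.
rewrite big_ord_recl expn0 muln1 /=.
under eq_bigr => j _ do rewrite /bump /= add1n expnS mulnCA.
rewrite -big_distrr /= addnC mulnC; case: i => [|i].
  by rewrite expn0 divn1 modnMDl modn_small.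
by rewrite expnS divnMA divnMDl // (divn_small (cb _)) addn0 (IH (fun j => c j.+1)).
Qed.

Lemma digit_big b k j : 1 < b -> k <= j -> digit b k j = 0.
Proof.
move=> b1 kj; rewrite /digit divn_small ?mod0n //.
by apply: leq_ltn_trans kj _; apply: ltn_expl.
Qed.

Lemma sum_digit b J k : k < b ^ J -> 1 < b ->
  k = \sum_(j < J) digit b k j * b ^ j.
Proof.
move=> kJ b1; elim: J k kJ => [|J IH] k kJ.
  by rewrite big_ord0; move: kJ; rewrite expn0 ltnS leqn0 => /eqP.
have b0 : 0 < b by apply: ltnW.
rewrite big_ord_recl expn0 muln1 /digit expn0 divn1 /=.
under eq_bigr => j _ do rewrite /bump /= add1n expnS divnMA mulnCA.
by rewrite -big_distrr /= -(IH (k %/ b)) ?ltn_divLR -?expnSr // addnC mulnC -divn_eq.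
Qed.

Lemma Mb_sumP b k : 1 < b ->
  (k \in Mb b) <->
  (exists J, exists c : nat -> bool, k = \sum_(j < J) c j * b ^ j).
Proof.
move=> b1; split=> [/forallP kM | [J [c ->]]]; last first.
  by apply/forallP => j; rewrite digit_sum //; case: (_ && _).
exists k; exists (fun j => digit b k j == 1).
apply: etrans (sum_digit (ltn_expl k b1) b1) _; apply: eq_bigr => j _.
by congr (_ * _); case: digit (kM j) => [|[|]].
Qed.

Lemma dmap_sum b t J (c : nat -> bool) : 1 < b ->
  dmap b t (\sum_(j < J) c j * b ^ j) = \sum_(j < J) c j * t ^ j.
Proof.
move=> b1; rewrite /dmap; set k := \sum_(j < J) _.
have ext m : k <= m ->
    \sum_(j < k) digit b k j * t ^ j = \sum_(j < m) digit b k j * t ^ j.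
  move=> km; rewrite (big_ord_widen m (fun j => digit b k j * t ^ j) km).
  rewrite big_mkcond; apply: eq_bigr => j _; case: ltnP => // kj.
  by rewrite digit_big.
rewrite (ext (k + J)) ?leq_addr //.
rewrite (big_ord_widen (k + J) (fun j => c j * t ^ j) (leq_addl _ _)).
rewrite [RHS]big_mkcond; apply: eq_bigr => j _; rewrite digit_sum //.
by case: ltnP.
Qed.

End Digits.

Section Omega.
Variables (rho : nat) (lam : 'I_rho -> nat).

(* Index set of the families (x_{l,i}), 1 <= l <= rho, 1 <= i <= lambda_l.
   Ordinals are 0-based: i : 'I_(lam l) stands for the index i.+1. *)
Definition idx : finType := {l : 'I_rho & 'I_(lam l)}.

Definition ix (l : 'I_rho) (i : 'I_(lam l)) : idx :=
  Tagged (fun l => 'I_(lam l)) i.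

Definition zvar (l : 'I_rho) (i : 'I_(lam l)) : {mpoly int[#|idx|]} :=
  'X_(enum_rank (ix i)).

Local Open Scope ring_scope.

Definition factor (b : nat) (t : forall l : 'I_rho, 'I_(lam l) -> nat)
    (j : nat) (l : 'I_rho) : {poly {mpoly int[#|idx|]}} :=
  1 + \sum_(i < lam l) zvar i ^+ (t l i ^ j)%N *: 'X^(i.+1 * b ^ j)%N.

Definition partial_product b (t : forall l : 'I_rho, 'I_(lam l) -> nat)
    (J : nat) : {poly {mpoly int[#|idx|]}} :=
  \prod_(j < J) \prod_(l < rho) factor b t j l.

(* The identity of formal power series
     \sum_n Omega n q^n = \prod_(j >= 0) \prod_l factor b t j l,
   the infinite product being the q-adic limit of its partial products: every
   coefficient is eventually constant. *)
Definition is_Omega b (t : forall l : 'I_rho, 'I_(lam l) -> nat)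
    (Omega : nat -> {mpoly int[#|idx|]}) : Prop :=
  forall n, exists N, forall J, (N <= J)%N ->
    (partial_product b t J)`_n = Omega n.

Lemma is_Omega_unique b t Om Om' :
  is_Omega b t Om -> is_Omega b t Om' -> Om =1 Om'.
Proof.
move=> H H' n; have [N HN] := H n; have [N' HN'] := H' n.
by rewrite -(HN (maxn N N')) ?leq_maxl // HN' ?leq_maxr.
Qed.

Lemma is_Omega_exists b t : (1 < b)%N -> exists Om, is_Omega b t Om.
Proof.
move=> b1; exists (fun n => (partial_product b t n)`_n) => n; exists n => J.
elim: J => [|J IH]; first by rewrite leqn0 => /eqP ->.
rewrite leq_eqVlt => /predU1P[->//|]; rewrite ltnS => nJ; rewrite -(IH nJ).
have nbJ : (n < b ^ J)%N by apply: leq_ltn_trans nJ _; apply: ltn_expl.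
have [P EP] : exists P, \prod_(l < rho) factor b t J l = 1 + P * 'X^(b ^ J)%N.
  elim/big_ind: _ => [|x y [P ->] [Q ->]|l _].
  - by exists 0; rewrite mul0r addr0.
  - exists (Q + P * (1 + Q * 'X^(b ^ J)%N)).
    by rewrite mulrDl mul1r [in RHS]mulrDl addrA [in RHS]mulrAC.
  - exists (\sum_(i < lam l) zvar i ^+ (t l i ^ J)%N *: 'X^(i * b ^ J)%N).
    rewrite /factor mulr_suml; congr (_ + _); apply: eq_bigr => i _.
    by rewrite -scalerAl -exprD mulSn addnC.
rewrite /partial_product big_ord_recr /= EP mulrDr mulr1 mulrA coefD coefMXn.
by rewrite nbJ addr0.
Qed.

End Omega.

Section Solutions.
Variables (rho : nat) (lam : 'I_rho -> nat).

(* The weight \sum_l \sum_i i * k_{l,i} of a family of integers. *)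
Definition weight (k : idx lam -> nat) : nat :=
  \sum_(l < rho) \sum_(i < lam l) i.+1 * k (ix i).

(* A family of weight n has all its members at most n, so that summing over
   families with values in 'I_n.+1 misses none of them. *)
Lemma weight_bound (k : idx lam -> nat) n x : weight k = n -> k x <= n.
Proof.
case: x => l i <-; rewrite /weight (bigD1 l) //= (bigD1 i) //= -/(ix i).
by rewrite mulSn -!addnA leq_addr.
Qed.

End Solutions.

(* Main.v *)
Require Import Defs.
From HB Require Import structures.
From mathcomp Require Import all_boot all_order all_algebra.
From mathcomp Require Import mpoly.

(* Expanding the product amounts to choosing, for each position j and each l,
   either the summand 1 or one summand of index i. Collecting in k_{l,i} the
   powers b^j of the positions where i was chosen gives the families of members
   of M_b such that, for every l, no two of the k_{l,1}, ..., k_{l,lambda_l}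
   share a digit 1. By Kummer's theorem at the prime 2 (no carries), these are
   the families whose starred multinomial coefficients are all 1. *)

Set Implicit Arguments.
Unset Strict Implicit.
Unset Printing Implicit Defensive.
Import GRing.Theory.

(** Meant for maps that are mutually inverse only between [P] and [Q], with no control elsewhere. *)
Lemma reindex_can2 (R : Type) (e : R) (op : Monoid.com_law e)
    (I J : finType) (P : pred I) (Q : pred J) (F : I -> R) (G : J -> R)
    (h : I -> J) (h' : J -> I) :
  (forall i, P i -> [/\ Q (h i), h' (h i) = i & F i = G (h i)]) ->
  (forall j, Q j -> P (h' j) /\ h (h' j) = j) ->
  \big[op/e]_(i | P i) F i = \big[op/e]_(j | Q j) G j.
Proof.
move=> hP hQ; rewrite (reindex_onto h' h) => [|i /hP[]//].
apply: eq_big => j.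
- apply/andP/idP => [[/hP[Qhj _ _] /eqP hj]|/hQ[Pj ->]]; last by [].
  by rewrite -hj.
- by case/andP => /hP[_ _ ->] /eqP ->.
Qed.

(** * Parity of multinomial coefficients via 2-adic valuations *)

Section MultinomialParity.
Local Open Scope nat_scope.

Lemma eq_multinomial r (m m' : 'I_r -> nat) :
  m =1 m' -> multinomial m = multinomial m'.
Proof.
move=> mm'; rewrite /multinomial (eq_bigr _ (fun i _ => mm' i)).
by congr (_ %/ _); apply: eq_bigr => i _; rewrite mm'.
Qed.

Lemma eq_multinomial_star_b b r (k k' : 'I_r -> nat) :
  k =1 k' -> multinomial_star_b b k = multinomial_star_b b k'.
Proof.
move=> kk'; rewrite /multinomial_star_b /multinomial_star.
by rewrite (@eq_multinomial _ _ (fun i => dmap b 2 (k' i))) // => i; rewrite kk'.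
Qed.

Lemma dvdn_prod_fact (I : Type) (s : seq I) (m : I -> nat) :
  \prod_(i <- s) (m i)`! %| (\sum_(i <- s) m i)`!.
Proof.
elim: s => [|i s IH]; first by rewrite !big_nil.
rewrite !big_cons; apply: (dvdn_trans (dvdn_mul (dvdnn _) IH)).
rewrite -(bin_fact (leq_addr _ _)) addKn; exact: dvdn_mull.
Qed.

Lemma logn_prod (I : Type) (s : seq I) (p : nat) (m : I -> nat) :
  (forall i, 0 < m i) ->
  logn p (\prod_(i <- s) m i) = \sum_(i <- s) logn p (m i).
Proof.
move=> m_gt0; elim: s => [|i s IH]; first by rewrite !big_nil logn1.
by rewrite !big_cons lognM ?IH // prodn_gt0.
Qed.

(** One step of Legendre's formula: odd factors contribute nothing, and the even factors 2, 4, ...,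
    2m are the doubles of 1, ..., m. *)
Lemma logn2_fact_double m (c : bool) :
  logn 2 (c + m.*2)`! = m + logn 2 m`!.
Proof.
have odd_part n : logn 2 (n.*2.+1)`! = logn 2 (n.*2)`!.
  by rewrite factS lognM ?fact_gt0 // logn_coprime // coprime2n /= odd_double.
have -> : logn 2 (c + m.*2)`! = logn 2 (m.*2)`!.
  by case: c => //; apply: odd_part.
elim: m => [|m IH]; first by rewrite double0.
rewrite doubleS factS lognM ?fact_gt0 // odd_part IH.
rewrite -doubleS -mul2n lognM // logn_prime //= factS lognM ?fact_gt0 //.
by rewrite addnACA.
Qed.

Lemma leq_logn_fact p m n : m <= n -> logn p m`! <= logn p n`!.
Proof.
move=> mn; apply: dvdn_leq_log; first exact: fact_gt0.
by rewrite -(bin_fact mn) mulnCA dvdn_mulr.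
Qed.

Lemma leq_sum_logn_fact p r (m : 'I_r -> nat) :
  \sum_(i < r) logn p (m i)`! <= logn p (\sum_(i < r) m i)`!.
Proof.
rewrite -logn_prod => [|i]; last exact: fact_gt0.
by apply: dvdn_leq_log; [exact: fact_gt0 | exact: dvdn_prod_fact].
Qed.

(** The division being exact, the valuation of the quotient is a difference; oddness means that this
    difference vanishes. *)
Lemma odd_multinomial r (m : 'I_r -> nat) :
  odd (multinomial m) =
  (logn 2 (\sum_(i < r) m i)`! == \sum_(i < r) logn 2 (m i)`!).
Proof.
have dv := dvdn_prod_fact (index_enum 'I_r) m.
have P_gt0 : 0 < \prod_(i < r) (m i)`! by apply: prodn_gt0 => i; apply: fact_gt0.
have m_gt0 : 0 < multinomial m.
  by rewrite /multinomial divn_gt0 //; apply: dvdn_leq dv; apply: fact_gt0.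
rewrite eqn_leq leq_sum_logn_fact andbT -logn_prod => [|i]; last exact: fact_gt0.
rewrite -subn_eq0 -logn_div // -/(multinomial m) lognE /= m_gt0 /= dvdn2.
by case: (odd _).
Qed.

(** Splits off the lowest binary digits [c i]: the coefficient is odd exactly when they produce no
    carry and the coefficient of the halves is odd. *)
Lemma odd_multinomial_double r (c : 'I_r -> bool) (m : 'I_r -> nat) :
  odd (multinomial (fun i => c i + (m i).*2)) =
  (\sum_(i < r) c i <= 1) && odd (multinomial m).
Proof.
rewrite !odd_multinomial.
under [X in _ == X]eq_bigr => i _ do rewrite logn2_fact_double.
rewrite !big_split /=; set C := \sum_(i < r) c i.
have -> : \sum_(i < r) (m i).*2 = (\sum_(i < r) m i).*2.
  by rewrite -mul2n big_distrr /=; apply: eq_bigr => i _; rewrite mul2n.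
set M := \sum_(i < r) m i; set V := \sum_(i < r) _.
(* [C./2] is the carry out of the lowest position. *)
rewrite -[C in C + _]odd_double_half -addnA -doubleD logn2_fact_double.
have VM : V <= logn 2 M`! := leq_sum_logn_fact 2 m.
have MC : logn 2 M`! <= logn 2 (C./2 + M)`! by apply/leq_logn_fact/leq_addl.
have -> : (C <= 1) = (C./2 == 0) by case: C {MC} => [|[|]].
rewrite addnAC [_ + M]addnC eqn_add2l addnC.
case: (C./2) MC => [|h] MC; first by rewrite addn0 add0n.
(* A positive carry makes the valuation of the numerator strictly larger, by [VM] and [MC]. *)
rewrite gtn_eqF // addnS ltnS; apply: leq_trans (leq_addr _ _).
exact: leq_trans MC.
Qed.

Lemma odd_multinomial_bits r J (c : 'I_r -> nat -> bool) :
  odd (multinomial (fun i => \sum_(j < J) c i j * 2 ^ j)) =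
  [forall j : 'I_J, \sum_(i < r) c i j <= 1].
Proof.
elim: J c => [|J IH] c.
  rewrite (@eq_multinomial _ _ (fun => 0)) => [|i]; last by rewrite big_ord0.
  rewrite odd_multinomial !big1_eq; apply/esym/forallP; by case.
rewrite (@eq_multinomial _ _ (fun i => c i 0 + (\sum_(j < J) c i j.+1 * 2 ^ j).*2)); last first.
  move=> i; rewrite big_ord_recl expn0 muln1 -mul2n big_distrr /=.
  by congr (_ + _); apply: eq_bigr => j _; rewrite /bump /= expnS mulnCA.
rewrite odd_multinomial_double (IH (fun i j => c i j.+1)).
apply/andP/forallP => [[c0 /forallP cS] j|cJ].
  by case: (unliftP ord0 j) => [j'|] -> //; apply: cS.
by split; [apply: (cJ ord0) | apply/forallP => j; apply: (cJ (lift ord0 j))].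
Qed.

(** [dmap b 2] reinterprets the base-b digits as binary digits, so the parity criterion applies to
    the same [c]. *)
Lemma multinomial_star_bE b r J (k : 'I_r -> nat) (c : 'I_r -> nat -> bool) :
  1 < b -> (forall i, k i = \sum_(j < J) c i j * b ^ j) ->
  multinomial_star_b b k = [forall j : 'I_J, \sum_(i < r) c i j <= 1].
Proof.
move=> b1 kE; rewrite /multinomial_star_b /multinomial_star modn2.
rewrite -odd_multinomial_bits; congr (nat_of_bool (odd _)).
by apply: eq_multinomial => i; rewrite kE dmap_sum.
Qed.

End MultinomialParity.

(** * Expansion of the partial products over choices *)

Section Choices.
Variables (b rho : nat) (lam : 'I_rho -> nat).
Variable t : forall l : 'I_rho, 'I_(lam l) -> nat.
Local Open Scope ring_scope.

Local Notation I := (idx lam).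
Local Notation z x := ('X_(enum_rank x) : {mpoly int[#|idx lam|]}).
Local Notation tx x := (t (tagged x)).

(* [None] picks the summand 1 of a factor, and [Some x] the one of index x. *)
Definition choice_ok (l : 'I_rho) : pred (option I) :=
  fun o => if o is Some x then tag x == l else true.

Lemma big_idx (R : Type) (e : R) (op : Monoid.com_law e) (F : I -> R) :
  \big[op/e]_(l < rho) \big[op/e]_(i < lam l) F (ix i) = \big[op/e]_x F x.
Proof.
rewrite (@sig_big_dep _ _ _ _ _ xpredT (fun=> xpredT) (fun l i => F (ix i))).
by apply: eq_bigr => -[].
Qed.

Lemma weightE (k : I -> nat) : weight k = (\sum_(x : I) (tagged x).+1 * k x)%N.
Proof. by rewrite -big_idx. Qed.

(** Every summand is written with exponents summed over all indices, all but at most one being 0;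
    multiplying summands then only adds exponents. *)
Lemma factor_choice j l :
  factor b t j l =
  \sum_(o | choice_ok l o)
    (\prod_x z x ^+ ((o == Some x) * tx x ^ j)%N) *:
      'X^(\sum_x (o == Some x) * ((tagged x).+1 * b ^ j))%N.
Proof.
rewrite (bigD1 None) //= /factor; congr (_ + _).
  by rewrite !big1 ?expr0 ?scale1r // => x _; rewrite mul0n.
rewrite (reindex_omap Some id) /=; last by case.
transitivity (\sum_(x : I | tag x == l)
    z x ^+ (tx x ^ j)%N *: 'X^((tagged x).+1 * b ^ j)%N : {poly {mpoly int[#|I|]}}).
  (* Letting the row [l'] vary turns the sum over row [l] into a sum over dependent pairs restricted
     to tag [l]. *)
  pose G l' (i : 'I_(lam l')) : {poly {mpoly int[#|I|]}} :=
    zvar i ^+ (t i ^ j)%N *: 'X^(i.+1 * b ^ j)%N.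
  transitivity (\sum_(l' | l' == l) \sum_(i < lam l') G l' i).
    by rewrite big_pred1_eq.
  rewrite (@sig_big_dep _ _ _ _ _ (pred1 l) (fun=> xpredT) G).
  by apply: eq_big => [x|[l' i] _]; rewrite ?andbT.
apply: eq_big => [x|x _]; first by rewrite eqxx !andbT.
congr (_ *: 'X^_).
  rewrite (bigD1 x) //= eqxx mul1n big1 ?mulr1 // => y yx.
  by rewrite (inj_eq Some_inj) eq_sym (negPf yx) mul0n.
rewrite (bigD1 x) //= eqxx mul1n big1 ?addn0 // => y yx.
by rewrite (inj_eq Some_inj) eq_sym (negPf yx).
Qed.

Section Positions.
Variable J : nat.
Implicit Type f : {ffun 'I_J * 'I_rho -> option I}.

(* The number whose base-b digit at position j is 1 exactly when f chooses x at
   j. *)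
Definition collect f (x : I) : nat :=
  (\sum_(j < J) (f (j, tag x) == Some x) * b ^ j)%N.

(** An admissible [f] can choose [x] only at pairs whose second component is [tag x]. *)
Lemma sum_choice f (x : I) (e : nat -> nat) :
  f \in family (fun p => choice_ok p.2) ->
  (\sum_p (f p == Some x) * e p.1 =
   \sum_(j < J) (f (j, tag x) == Some x) * e j)%N.
Proof.
move=> /familyP f_ok.
transitivity (\sum_(j < J) \sum_(l < rho) (f (j, l) == Some x) * e j)%N.
  by rewrite pair_bigA; apply: eq_bigr => -[].
apply: eq_bigr => j _; rewrite (bigD1 (tag x)) //= big1 ?addn0 // => l lx.
case: eqP => // fx; have := f_ok (j, l).
by rewrite fx => /eqP /= xl; rewrite xl eqxx in lx.
Qed.

Lemma coef_partial_product n :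
  (partial_product b t J)`_n =
  \sum_(f : {ffun 'I_J * 'I_rho -> option I} |
        (f \in family (fun p => choice_ok p.2)) && (weight (collect f) == n))
    \prod_x z x ^+ (\sum_(j < J) (f (j, tag x) == Some x) * tx x ^ j)%N.
Proof.
rewrite /partial_product pair_bigA /=.
under eq_bigr => p _ do rewrite factor_choice.
(* By distributivity each admissible [f] contributes one monomial; its degree in q, named [w] below,
   is the weight of the collected family. *)
rewrite bigA_distr_big_dep coef_sum big_mkcondr; apply: eq_bigr => f f_ok.
rewrite scaler_prod coefZ prodrXr coefXn exchange_big [X in _ == X]exchange_big /=.
set w := (\sum_x _)%N.
have -> : w = weight (collect f).
  rewrite weightE; apply: eq_bigr => x _.
  under eq_bigr => p _ do rewrite mulnCA.
  by rewrite -big_distrr /= (sum_choice _ (fun j => b ^ j)%N f_ok).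
rewrite eq_sym; case: eqP => _; rewrite ?mulr0 // mulr1.
apply: eq_bigr => x _.
by rewrite prodrXr (sum_choice _ (fun j => tx x ^ j)%N f_ok).
Qed.

(** Extended by [false] beyond position [J], to serve as a digit sequence on all of [nat]. *)
Definition bit f (x : I) (j : nat) : bool :=
  if insub j is Some j' then f (j', tag x) == Some x else false.

Lemma bitE f x (j : 'I_J) : bit f x j = (f (j, tag x) == Some x).
Proof. by rewrite /bit valK. Qed.

Lemma collectE f x : collect f x = (\sum_(j < J) bit f x j * b ^ j)%N.
Proof. by apply: eq_bigr => j _; rewrite bitE. Qed.

(** * Correspondence between choices and digit-disjoint families *)

Hypothesis b_gt1 : (1 < b)%N.

Lemma digit_collect f x (j : 'I_J) :
  digit b (collect f x) j = (f (j, tag x) == Some x).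
Proof. by rewrite collectE digit_sum // ltn_ord bitE. Qed.

Lemma collect_Mb f x : collect f x \in Mb b.
Proof. by apply/Mb_sumP => //; exists J, (bit f x); apply: collectE. Qed.

Lemma dmap_collect d f x :
  dmap b d (collect f x) = (\sum_(j < J) (f (j, tag x) == Some x) * d ^ j)%N.
Proof.
by rewrite collectE dmap_sum //; apply: eq_bigr => j _; rewrite bitE.
Qed.

Lemma multinomial_star_collect f l :
  multinomial_star_b b (fun i : 'I_(lam l) => collect f (ix i)) = 1%N.
Proof.
rewrite (multinomial_star_bE (c := fun i : 'I_(lam l) => bit f (ix i)) b_gt1
           (fun i => collectE f (ix i))).
suff -> : [forall j : 'I_J, \sum_(i < lam l) bit f (ix i) j <= 1]%N by [].
apply/forallP => j; under eq_bigr => i _ do rewrite bitE /=.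
(* Enlarging the row to all indices leaves at most one nonzero term, since [f (j, l)] is a single
   choice. *)
apply: (@leq_trans (\sum_x (f (j, l) == Some x))%N).
  by rewrite -[leqRHS]big_idx [leqRHS](bigD1 l) //= leq_addr.
case: (f (j, l)) => [y|]; last by rewrite big1.
rewrite (bigD1 y) //= eqxx big1 // => x xy.
by rewrite (inj_eq Some_inj) eq_sym (negPf xy).
Qed.

(** Candidate inverse of [collect]: the picked index is determined by [k] when at most one member of
    the row has digit 1 at the position. *)
Definition choice_of (k : I -> nat) : {ffun 'I_J * 'I_rho -> option I} :=
  [ffun p : 'I_J * 'I_rho =>
     [pick x | (tag x == p.2) && (digit b (k x) p.1 == 1%N)]].

Lemma choice_of_ok k : choice_of k \in family (fun p => choice_ok p.2).
Proof.
by apply/familyP => p; rewrite ffunE; case: pickP => [x /andP[]|].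
Qed.

(** The digits of [collect f x] record where [f] chose [x]. Pointwise equality lets [k] be a family
    of ordinals read as naturals. *)
Lemma collectK f (k : I -> nat) : f \in family (fun p => choice_ok p.2) ->
  k =1 collect f -> choice_of k = f.
Proof.
move=> /familyP f_ok kf; apply/ffunP => -[j l]; rewrite ffunE /=.
case: pickP => [x /andP[/eqP <-]|no_x].
  by rewrite kf digit_collect eqb1 => /eqP ->.
case fjl: (f (j, l)) => [x|//]; have := f_ok (j, l); rewrite fjl => /eqP /= xl.
by have := no_x x; rewrite xl eqxx kf digit_collect xl fjl eqxx.
Qed.

Lemma leq_sum_inj (l : 'I_rho) (g : I -> bool) (x y : I) :
  (\sum_(i < lam l) g (ix i) <= 1)%N -> tag x = l -> tag y = l -> g x -> g y ->
  x = y.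
Proof.
case: x y => lx i [ly i'] /= + xl yl; subst lx ly => g1 gi gi'.
have [-> //|i'i] := eqVneq i i'.
move: g1; rewrite (bigD1 i) //= (bigD1 i') 1?eq_sym //=.
by rewrite /ix gi gi'.
Qed.

(** The bound [b ^ J] puts all nonzero digits at the [J] available positions, and the starred
    coefficients make the picked index unique. *)
Lemma choice_ofK (k : I -> nat) :
  (forall x, k x \in Mb b) -> (forall x, k x < b ^ J)%N ->
  (forall l, multinomial_star_b b (fun i : 'I_(lam l) => k (ix i)) = 1%N) ->
  collect (choice_of k) =1 k.
Proof.
move=> kM k_lt k_star x.
pose c y j := digit b (k y) j == 1%N.
have kE y : k y = (\sum_(j < J) c y j * b ^ j)%N.
  rewrite [LHS](sum_digit (k_lt y) b_gt1); apply: eq_bigr => j _.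
  (* [Mb] tests only the positions below [k y]; from there on the digits vanish. *)
  congr (_ * _)%N; rewrite /c; have [kj|kj] := leqP (k y) j.
    by rewrite digit_big.
  by have /forallP/(_ (Ordinal kj)) /= := kM y; case: digit => [|[|]].
have c_le1 l (j : 'I_J) : (\sum_(i < lam l) c (ix i) j <= 1)%N.
  have := k_star l.
  rewrite (multinomial_star_bE (c := fun i : 'I_(lam l) => c (ix i)) b_gt1
             (fun i => kE (ix i))).
  by move/eqP; rewrite eqb1 => /forallP.
rewrite [RHS]kE; apply: eq_bigr => j _; rewrite ffunE /=; congr (_ * _)%N.
case: pickP => [y /andP[/eqP yx cy]|no_x]; last first.
  by have := no_x x; rewrite eqxx /= -/(c x j) => ->.
rewrite (inj_eq Some_inj); case: (eqVneq y x) => [<-|yx'].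
  by rewrite /c cy.
(* If another index [y] was picked, [x] cannot have digit 1 at [j] as well. *)
case cx: (c x j) => //; case/eqP: yx'.
exact: (leq_sum_inj (g := c^~ j) (c_le1 (tag x) j) yx erefl cy cx).
Qed.

End Positions.
End Choices.

(** * Transfer to the sum over bounded families *)

Theorem theorem6p3 (b rho : nat) (lam : 'I_rho -> nat)
    (t : forall l : 'I_rho, 'I_(lam l) -> nat)
    (Omega : nat -> {mpoly int[#|idx lam|]}) :
  (2 <= b)%N -> (1 <= rho)%N ->
  (forall l : 'I_rho, (1 <= lam l)%N) ->
  (forall l l' : 'I_rho, (l <= l')%N -> (lam l <= lam l')%N) ->
  (forall (l : 'I_rho) (i : 'I_(lam l)), (1 <= t l i)%N) ->
  is_Omega b t Omega ->
  forall n : nat,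
    Omega n =
    (\sum_(k : {ffun idx lam -> 'I_n.+1} |
           [forall x, (k x : nat) \in Mb b] && (weight (fun x => k x) == n))
       \prod_(l < rho)
         ((multinomial_star_b b (fun i : 'I_(lam l) => k (ix i)))%:R
          * \prod_(i < lam l) zvar i ^+ dmap b (t l i) (k (ix i))))%R.
Proof.
move=> b_gt1 _ _ _ _ Omega_gen n; have [N OmegaN] := Omega_gen n.
(* [J >= N] makes the coefficient stable; [J >= n] gives [n < b ^ J], so members bounded by [n] have
   all their digits below position [J]. *)
pose J := maxn N n; rewrite -(OmegaN J) ?leq_maxl // coef_partial_product.
pose star (k : {ffun idx lam -> 'I_n.+1}) :=
  [forall l, multinomial_star_b b (fun i : 'I_(lam l) => k (ix i)) == 1%N].
(* The starred coefficients are 0 or 1, so their product acts as the filter [star]. *)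
transitivity (\sum_(k : {ffun idx lam -> 'I_n.+1} |
           ([forall x, (k x : nat) \in Mb b] && (weight (fun x => k x) == n))
           && star k)
    \prod_x ('X_(enum_rank x) : {mpoly int[#|idx lam|]})
              ^+ dmap b (t (tag x) (tagged x)) (k x))%R; last first.
  rewrite big_mkcondr; apply: eq_bigr => k _; rewrite big_split /=.
  rewrite (big_idx _ (fun x => 'X_(enum_rank x)
             ^+ dmap b (t (tag x) (tagged x)) (k x))%R).
  case: ifP => [/forallP k1|/negbT].
    by rewrite [X in (_ = X * _)%R]big1 ?mul1r // => l _; rewrite (eqP (k1 l)).
  rewrite negb_forall => /existsP[l kl1]; rewrite [X in (_ = X * _)%R](bigD1 l) //=.
  suff -> : multinomial_star_b b (fun i : 'I_(lam l) => k (ix i)) = 0%N.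
    by rewrite !mul0r.
  by move: kl1; rewrite /multinomial_star_b /multinomial_star modn2; case: odd.
(* [inord] preserves the values for every [f] of weight [n], by [weight_bound]; its default value
   can occur only for other [f]. *)
pose h f : {ffun idx lam -> 'I_n.+1} := [ffun x => inord (collect b (J := J) f x)].
apply: (@reindex_can2 _ _ _ _ _ _ _ _ _ h
          (fun k => choice_of b J (fun x => k x))).
- move=> f /andP[f_ok /eqP f_n].
  have hE x : h f x = collect b f x :> nat.
    by rewrite ffunE inordK // ltnS -f_n; apply: weight_bound.
  split; last by apply: eq_bigr => x _; rewrite hE dmap_collect.
    apply/andP; split; first apply/andP; first split.
    + by apply/forallP => x; rewrite hE collect_Mb.
    + by rewrite -[X in _ == X]f_n !weightE; apply/eqP/eq_bigr => x _; rewrite hE.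
    + apply/forallP => l; rewrite -(multinomial_star_collect b_gt1 f l).
      by apply/eqP/eq_multinomial_star_b => i; rewrite hE.
  exact: (collectK b_gt1 f_ok hE).
- move=> k /andP[/andP[/forallP kM /eqP k_n] /forallP k1].
  have kK : collect b (choice_of b J (fun x => k x)) =1 (fun x => k x).
    apply: choice_ofK => // [x|l]; last exact/eqP.
    apply: leq_trans (ltn_ord _) _; apply: leq_trans (ltn_expl n b_gt1) _.
    by rewrite leq_pexp2l ?leq_maxr // ltnW.
  split; last by apply/ffunP => x; rewrite ffunE kK inord_val.
  rewrite choice_of_ok -[X in _ == X]k_n !weightE /=.
  by apply/eqP/eq_bigr => x _; rewrite kK.
Qed.
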